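(* 1. (Construction T1) A $g\times g$ $1$-PDA $P$ and its transpose $P^T$ are Blackburn-compatible w.r.t. any $g\times g$ PDA $P_\ast$ with $\ast$ in all main diagonal cells. 2. (Construction T2) For integers $g\ge 1$ and $i$, a $g\times g$ $1$-PDA $P$ and the array $\pi^i_{AD,1}(P^T)$ are Blackburn-compatible w.r.t. any $g\times g$ PDA $P_\ast$ with $\ast$ in all cells of the main diagonal and of the $i$-th diagonal. In both cases the integers in $P_\ast$ are assumed to be disjoint from those in $P$.
   Context: Notation: $[n]=\{0,1,\dots,n-1\}$; rows and columns are indexed from $0$. For positive integers $K,f$, a nonnegative integer $Z$ and a finite set $\mathcal{S}$ of integers, a $(K,f,Z,\mathcal{S})$ placement delivery array (PDA) is an $f\times K$ array $P=[p_{j,k}]$ with entries in $\mathcal{S}\cup\{\ast\}$ such that: (C1) $\ast$ appears exactly $Z$ times in each column; (C2) each $s\in\mathcal{S}$ occurs at least once; (C3, Blackburn property) if two distinct cells $(j_1,k_1)$, $(j_2,k_2)$ contain the same integer then $p_{j_1,k_2}=p_{j_2,k_1}=\ast$. A $1$-PDA is a PDA in which each integer of $\mathcal{S}$ occurs exactly once. Blackburn compatibility: for arrays $P_0,P_1,P_\ast$ of the same size with entries integers or $\ast$, $P_0$ and $P_1$ are Blackburn-compatible w.r.t. $P_\ast$ if, whenever $p^{(0)}_{i_1j_1}=p^{(1)}_{i_2j_2}\neq\ast$, we have $p^{(\ast)}_{i_1j_2}=p^{(\ast)}_{i_2j_1}=\ast$. For a $g\times g$ array the $i$-th diagonal is the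 set of cells $\{(x,y): y\equiv x+i \bmod g\}$; the $0$-th diagonal is the main diagonal. For a $g\times g$ array $P$, $\pi_{AD,1}(P)$ equals $P$ except that the anti-diagonal entries are cyclically rotated: the entry at anti-diagonal cell $(a,b)$ (with $a+b=g-1$) moves to $(a-1,b+1)$ mod $g$; $\pi^i_{AD,1}$ denotes the $i$-fold iterate (inverse for negative $i$). *)

(* Defs.v *)
From HB Require Import structures.
From mathcomp Require Import all_boot all_order all_algebra.
From mathcomp Require Import finmap.

Set Implicit Arguments.
Unset Strict Implicit.
Unset Printing Implicit Defensive.

Import Order.TTheory GRing.Theory Num.Theory.

Local Open Scope nat_scope.

(* Arrays with f rows and K columns, indexed from 0, whose cells contain
   an integer ([Some s]) or the symbol * ([None]). *)
Definition array (f K : nat) : Type := 'M[option int]_(f, K).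

Record is_PDA (K f Z : nat) (S : {fset int}) (P : array f K) : Prop := IsPDA {
  PDA_entries : forall j k s, P j k = Some s -> s \in S;
  PDA_stars : forall k, #|[set j | P j k == None]| = Z;
  PDA_occurs : forall s, s \in S -> exists j k, P j k = Some s;
  PDA_Blackburn : forall j1 k1 j2 k2 s, (j1, k1) <> (j2, k2) ->
    P j1 k1 = Some s -> P j2 k2 = Some s ->
    P j1 k2 = None /\ P j2 k1 = None
}.

Definition is_1PDA (K f Z : nat) (S : {fset int}) (P : array f K) : Prop :=
  is_PDA Z S P /\
  forall s, s \in S -> #|[set c : 'I_f * 'I_K | P c.1 c.2 == Some s]| = 1.

Definition Blackburn_compatible (f K : nat) (P0 P1 Pstar : array f K) : Prop :=
  forall i1 j1 i2 j2, P0 i1 j1 = P1 i2 j2 -> P0 i1 j1 <> None ->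
    Pstar i1 j2 = None /\ Pstar i2 j1 = None.

Definition in_diag (g : nat) (i : int) (x y : 'I_g) : Prop :=
  (y%:Z = x%:Z + i %[mod g%:Z])%Z.

Definition stars_on_diag (g : nat) (i : int) (P : array g g) : Prop :=
  forall x y, in_diag i x y -> P x y = None.

Definition in_antidiag (g : nat) (x y : 'I_g) : bool := x + y == g.-1.

(* [ordS] and [ord_pred] are the cyclic successor and predecessor on ['I_g].
   The entry moved to (x, y) by [pi_AD1] comes from (x + 1, y - 1) mod g. *)
Definition pi_AD1 (g : nat) (P : array g g) : array g g :=
  (\matrix_(x, y) if in_antidiag x y then P (ordS x) (ord_pred y) else P x y)%R.

Definition pi_AD1_inv (g : nat) (P : array g g) : array g g :=
  (\matrix_(x, y) if in_antidiag x y then P (ord_pred x) (ordS y) else P x y)%R.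

Definition pi_AD1_iter (g : nat) (i : int) (P : array g g) : array g g :=
  match i with
  | Posz n => iter n (@pi_AD1 g) P
  | Negz n => iter n.+1 (@pi_AD1_inv g) P
  end.

Lemma in_antidiagE g (x y : 'I_g) : in_antidiag x y = (y == rev_ord x).
Proof.
rewrite /in_antidiag -val_eqE /=.
case: g x y => [[]//|g] x y /=.
by rewrite subSS -(eqn_add2l x y) subnKC // -ltnS.
Qed.

Lemma rev_ordS g (x : 'I_g) : rev_ord (ordS x) = ord_pred (rev_ord x).
Proof.
apply: val_inj => /=; case: g x => [[]//|g] x.
have [xg|gx] := ltnP x g.
  rewrite (@modn_small x.+1) // !subSS addnS /= -(subnSK xg) addSnnS modnDr.
  by rewrite modn_small // ltnS leq_subr.
have -> : x = g :> nat by apply/eqP; rewrite eqn_leq gx -ltnS ltn_ord.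
by rewrite modnn !subSS subn0 subnn add0n modn_small.
Qed.

Lemma in_antidiag_next g (x y : 'I_g) :
  in_antidiag (ordS x) (ord_pred y) = in_antidiag x y.
Proof. by rewrite !in_antidiagE rev_ordS (inj_eq (@ord_pred_inj g)). Qed.

Lemma in_antidiag_prev g (x y : 'I_g) :
  in_antidiag (ord_pred x) (ordS y) = in_antidiag x y.
Proof. by rewrite -in_antidiag_next ord_predK ordSK. Qed.

Lemma pi_AD1_moves g (P : array g g) (a b : 'I_g) :
  in_antidiag a b -> pi_AD1 P (ord_pred a) (ordS b) = P a b.
Proof. by move=> ab; rewrite mxE in_antidiag_prev ab ord_predK ordSK. Qed.

Lemma pi_AD1K g : cancel (@pi_AD1 g) (@pi_AD1_inv g).
Proof.
move=> P; apply/matrixP => x y; rewrite !mxE in_antidiag_prev ord_predK ordSK.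
by case: (in_antidiag x y).
Qed.

Lemma pi_AD1_invK g : cancel (@pi_AD1_inv g) (@pi_AD1 g).
Proof.
move=> P; apply/matrixP => x y; rewrite !mxE in_antidiag_next ordSK ord_predK.
by case: (in_antidiag x y).
Qed.

(* Main.v *)
(** In [P^T] the integer of cell (a, b) of [P] sits at (b, a), and a 1-PDA holds
    it nowhere else, so compatibility for T1 only involves the cells (a, a) and
    (b, b).  In T2 an integer on the anti-diagonal is moved further to
    (b - i, a + i), and the cells to inspect become (a, a + i) and (b - i, b),
    which lie on the i-th diagonal. *)
Require Import Defs.
From mathcomp Require Import all_boot all_order all_algebra.
From mathcomp Require Import finmap.

Set Implicit Arguments.
Unset Strict Implicit.
Unset Printing Implicit Defensive.

Import GRing.Theory.

Lemma in_diag_refl g (x : 'I_g) : in_diag 0%R x x.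
Proof. by rewrite /in_diag addr0. Qed.

Lemma in_diag_trans g (i j : int) (x y z : 'I_g) :
  in_diag i x y -> in_diag j y z -> in_diag (i + j)%R x z.
Proof. by rewrite /in_diag addrA => xy ->; rewrite -modzDml xy modzDml. Qed.

Lemma in_diag_opp g (i : int) (x y : 'I_g) : in_diag i x y -> in_diag (- i)%R y x.
Proof. by rewrite /in_diag => xy; rewrite -modzDml xy modzDml addrK. Qed.

Lemma in_diag_ordS g (x : 'I_g) : in_diag 1%R x (ordS x).
Proof. by rewrite /in_diag /= -modz_nat modz_mod -addn1 PoszD. Qed.

Lemma in_diag_ord_pred g (x : 'I_g) : in_diag (-1)%R x (ord_pred x).
Proof. by apply: in_diag_opp; have := in_diag_ordS (ord_pred x); rewrite ord_predK. Qed.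

Lemma pi_AD1_iter_off g (i : int) (P : array g g) (x y : 'I_g) :
  ~~ in_antidiag x y -> pi_AD1_iter i P x y = P x y.
Proof.
move=> /negbTE Nxy; case: i => n; rewrite /pi_AD1_iter.
  by elim: n => //= n IHn; rewrite mxE Nxy.
by elim: n.+1 => //= m IHm; rewrite mxE Nxy.
Qed.

(** Each rotation fetches its entry one row down and one column left, cyclically, and the inverse
    does the opposite, so the shifts add up to [i] in rows and [- i] in columns. Locating the source
    by [in_diag] avoids explicit modular indices and covers both signs of [i]. *)
Lemma pi_AD1_iter_on g (i : int) (P : array g g) (x y : 'I_g) :
  in_antidiag x y ->
  exists x' y', [/\ pi_AD1_iter i P x y = P x' y', in_diag i x x' & in_diag i y' y].
Proof.
case: i => n.
  rewrite /pi_AD1_iter; elim: n x y => [|n IHn] x y xy.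
    by exists x, y; split=> //; apply: in_diag_refl.
  (* The outermost rotation reads the [n]-fold iterate at this cell, again on the anti-diagonal. *)
  have [|x' [y' [Exy xx' yy']]] := IHn (ordS x) (ord_pred y).
    by rewrite in_antidiag_next.
  exists x', y'; rewrite /= mxE xy Exy -addn1 PoszD; split=> //.
    by rewrite addrC; apply: in_diag_trans (in_diag_ordS x) xx'.
  by apply: in_diag_trans yy' _; rewrite -{2}(ord_predK y); apply: in_diag_ordS.
(* [Negz n] is [-(n + 1)]; generalizing [n.+1] lets the induction start from zero inverse
   rotations. *)
rewrite /pi_AD1_iter NegzE; elim: n.+1 x y => [|m IHm] x y xy.
  by exists x, y; split=> //; apply: in_diag_refl.
have [|x' [y' [Exy xx' yy']]] := IHm (ord_pred x) (ordS y).
  by rewrite in_antidiag_prev.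
exists x', y'; rewrite /= mxE xy Exy -addn1 PoszD opprD; split=> //.
  by rewrite addrC; apply: in_diag_trans (in_diag_ord_pred x) xx'.
by apply: in_diag_trans yy' _; rewrite -{2}(ordSK y); apply: in_diag_ord_pred.
Qed.

(** The cells holding a given integer form a set of cardinality one, a singleton to which both cells
    belong. *)
Lemma is_1PDA_inj K f Z (S : {fset int}) (P : array f K) j1 k1 j2 k2 :
  is_1PDA Z S P -> P j1 k1 <> None -> P j1 k1 = P j2 k2 ->
  j1 = j2 /\ k1 = k2.
Proof.
case=> PDA_P uniqP; case E1: (P j1 k1) => [s|//] _ E2.
have /eqP/cards1P[c Ec] := uniqP s (PDA_entries PDA_P E1).
have: (j1, k1) \in [set c] by rewrite -Ec inE /= E1.
have: (j2, k2) \in [set c] by rewrite -Ec inE /= -E2.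
by rewrite !inE => /eqP<- /eqP[].
Qed.

Lemma Blackburn_compatible_pi_AD1_iter g (i : int) Z (S : {fset int})
    (P Pstar : array g g) :
  is_1PDA Z S P -> stars_on_diag 0%R Pstar -> stars_on_diag i Pstar ->
  Blackburn_compatible P (pi_AD1_iter i P^T%R) Pstar.
Proof.
move=> P1 star0 stari i1 j1 i2 j2 + Pn0.
have [/(pi_AD1_iter_on i P^T%R)[x' [y' [-> xx' yy']]]|Nxy] :=
  boolP (in_antidiag i2 j2).
  (* Transposing gives [i1 = y'] and [j1 = x'], so the cells to check are [(y', j2)] and
     [(i2, x')]. *)
  rewrite mxE => /(is_1PDA_inj P1 Pn0)[-> ->].
  by split; apply: stari.
rewrite pi_AD1_iter_off // mxE => /(is_1PDA_inj P1 Pn0)[-> ->].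
by split; apply/star0/in_diag_refl.
Qed.

Theorem lemma16 (g : nat) (hg : (0 < g)%N) :
  (forall (Z Zstar : nat) (S Sstar : {fset int}) (P Pstar : array g g),
     is_1PDA Z S P -> is_PDA Zstar Sstar Pstar ->
     [disjoint S & Sstar]%fset ->
     stars_on_diag 0%Z Pstar ->
     Blackburn_compatible P P^T%R Pstar)
  /\
  (forall (i : int)
     (Z Zstar : nat) (S Sstar : {fset int}) (P Pstar : array g g),
     is_1PDA Z S P -> is_PDA Zstar Sstar Pstar ->
     [disjoint S & Sstar]%fset ->
     stars_on_diag 0%Z Pstar -> stars_on_diag i Pstar ->
     Blackburn_compatible P (pi_AD1_iter i P^T%R) Pstar).
Proof.
split=> [Z Zs S Ss P Ps P1 _ _ star0|i Z Zs S Ss P Ps P1 _ _ star0 stari].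
  (* For [i = 0] the iterate is [P^T] by computation, and the main diagonal serves as the [i]-th
     one. *)
  exact: (@Blackburn_compatible_pi_AD1_iter g 0%R _ _ _ _ P1 star0 star0).
exact: Blackburn_compatible_pi_AD1_iter P1 star0 stari.
Qed.
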